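(* Let $\mathcal{H}$ be a complex separable Hilbert space, $V:G\to\mathcal{U}(\mathcal{H})$ a strongly continuous unitary representation of a group $G$, and $T$ a densely defined, $G$-invariant, symmetric operator on $\mathcal{H}$ with deficiency spaces $\mathcal{N}_\pm$. Let $K:\mathcal{N}_+\to\mathcal{N}_-$ be a unitary operator and let $T_K$ be the von Neumann self-adjoint extension of $T$ determined by $K$. Then $T_K$ is $G$-invariant if and only if $$[V(g),K]\xi=V(g)K\xi-KV(g)\xi=0\qquad\text{for all }\xi\in\mathcal{N}_+\text{ and all }g\in G .$$
   Context: An operator $S$ with domain $\mathcal{D}(S)$ is $G$-invariant if $V(g)\mathcal{D}(S)\subset\mathcal{D}(S)$ for all $g\in G$ and $V(g)S\Phi=SV(g)\Phi$ for all $g\in G$, $\Phi\in\mathcal{D}(S)$. The deficiency spaces of $T$ are $\mathcal{N}_{\pm}=\ker(T^{\dagger}\mp i\mathbb{I})$; for $G$-invariant $T$ they are invariant under all $V(g)$, so the commutator on $\mathcal{N}_+$ makes sense. For a unitary $K:\mathcal{N}_+\to\mathcal{N}_-$ the von Neumann extension $T_K$ of $T$ is the self-adjoint operator with domain $\mathcal{D}(T_K)=\mathcal{D}(\overline{T})\oplus(\mathbb{I}+K)\mathcal{N}_+$ and action $T_K(\Phi_0+(\mathbb{I}+K)\xi_+)=\overline{T}\Phi_0+i(\mathbb{I}-K)\xi_+$ for $\Phi_0\in\mathcal{D}(\overline{T})$, $\xi_+\in\mathcal{N}_+$, where $\overline{T}$ is the closure of $T$. *)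

(* Defs.v *)
From HB Require Import structures.
From mathcomp Require Import all_boot all_order all_algebra.
From mathcomp Require Import sesquilinear complex.
From mathcomp Require Import all_classical all_reals all_analysis.

Set Implicit Arguments.
Unset Strict Implicit.
Unset Printing Implicit Defensive.

Import Order.TTheory GRing.Theory Num.Theory.
Import numFieldNormedType.Exports.

Local Open Scope classical_set_scope.
Local Open Scope ring_scope.
Local Open Scope complex_scope.

(* The inner product is linear in its first argument and conjugate-linear in
   its second one; it induces the norm, for which the space is complete. *)
HB.mixin Record isHilbert (R : realType) H
    & CompleteNormedModule R[i] H := {
  hdot : {dot H for @Num.conj R[i]} ;
  hdot_norm : forall x : H, hdot x x = `|x| ^+ 2
}.

#[short(type="hilbertType")]
HB.structure Definition Hilbert (R : realType) :=
  {H of isHilbert R H & CompleteNormedModule R[i] H}.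

HB.mixin Record isTopologicalGroup G & Topological G & Group G := {
  mulg_continuous : continuous (fun p : G * G => (p.1 * p.2)%g) ;
  invg_continuous : continuous (fun x : G => (x^-1)%g)
}.

#[short(type="topologicalGroupType")]
HB.structure Definition TopologicalGroup :=
  {G of Topological G & Group G & isTopologicalGroup G}.

Definition separable (T : topologicalType) :=
  exists2 D : set T, countable D & dense D.

Section Operators.
Variables (R : realType) (H : hilbertType R).
Implicit Types (A B : set H) (x y z : H).

Local Notation "'[ x , y ]" := (hdot x y).

Definition subspace_set A :=
  A 0 /\ forall (a : R[i]) x y, A x -> A y -> A (a *: x + y).

Definition linear_on A (f : H -> H) :=
  forall (a : R[i]) x y, A x -> A y -> f (a *: x + y) = a *: f x + f y.

(* K is a unitary operator from the subspace A onto the subspace B; its values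
   outside A are irrelevant. *)
Record unitary_between A B (K : H -> H) : Prop := {
  unitary_linear : linear_on A K ;
  unitary_image : K @` A = B ;
  unitary_isometry : forall x y, A x -> A y -> '[K x, K y] = '[x, y]
}.

(* A possibly unbounded operator: op_fun is only meaningful on op_dom. *)
Record operator := Operator { op_dom : set H ; op_fun :> H -> H }.

Implicit Types S T : operator.

Definition linear_operator T :=
  subspace_set (op_dom T) /\ linear_on (op_dom T) T.

Definition densely_defined T := dense (op_dom T).

Definition symmetric_operator T :=
  forall x y, op_dom T x -> op_dom T y -> '[T x, y] = '[x, T y].

Definition op_graph T : set (H * H) :=
  [set p | op_dom T p.1 /\ p.2 = T p.1].

(* The operator whose graph is P, when P is the graph of a function. *)
Definition operator_of_graph (P : set (H * H)) : operator :=
  Operator [set x | exists y, P (x, y)]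
           (fun x => xget 0 [set y | P (x, y)]).

Definition op_closure T : operator :=
  operator_of_graph (closure (op_graph T)).

(* Single-valued as soon as T is densely defined. *)
Definition adjoint T : operator :=
  operator_of_graph
    [set p | forall x, op_dom T x -> '[T x, p.1] = '[x, p.2]].

Definition op_ker T : set H := [set x | op_dom T x /\ T x = 0].

Definition sub_scalar T (c : R[i]) : operator :=
  Operator (op_dom T) (fun x => T x - c *: x).

Definition deficiency_pos T : set H := op_ker (sub_scalar (adjoint T) 'i%C).
Definition deficiency_neg T : set H := op_ker (sub_scalar (adjoint T) (- 'i%C)).

Definition von_neumann_extension T (K : H -> H) : operator :=
  operator_of_graph
    [set p | exists Phi0 xi, [/\ op_dom (op_closure T) Phi0,
       deficiency_pos T xi,
       p.1 = Phi0 + (xi + K xi) &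
       p.2 = op_closure T Phi0 + 'i%C *: (xi - K xi)]].

Section Invariance.
Variable G : topologicalGroupType.

Record strongly_continuous_unitary_rep (V : G -> H -> H) : Prop := {
  rep_unitary : forall g, unitary_between setT setT (V g) ;
  rep1 : forall x, V 1%g x = x ;
  repM : forall g h x, V (g * h)%g x = V g (V h x) ;
  rep_continuous : forall x, continuous (fun g => V g x)
}.

Definition G_invariant (V : G -> H -> H) S :=
  (forall g, V g @` op_dom S `<=` op_dom S) /\
  (forall g x, op_dom S x -> V g (S x) = S (V g x)).

End Invariance.
End Operators.

(* Main.v *)
Require Import Defs.
From mathcomp Require Import all_boot all_order all_algebra.
From mathcomp Require Import sesquilinear complex.
From mathcomp Require Import all_classical all_reals all_analysis.
From mathcomp Require Import ring.

(* A graph-defined operator is G-invariant exactly when its graph is invariant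
   under V g x V g.  By continuity of V g, and by unitarity, both the graph of
   the closure of T and the graph of its adjoint are invariant, hence so are the
   deficiency spaces; the graph of T_K is then invariant when V g commutes
   with K.  Conversely, for xi in N_+, writing the image under V g of the point
   xi + K xi of D(T_K) as Phi0 + eta + K eta, the vector
   (V g xi - eta) + (V g K xi - K eta) lies in D(closure T).  Since D(closure T),
   N_+ and N_- are in direct sum, V g xi = eta and V g K xi = K eta. *)

Import Order.TTheory GRing.Theory Num.Theory.
Import numFieldNormedType.Exports.

Local Open Scope classical_set_scope.
Local Open Scope ring_scope.

Local Notation "'[ x , y ]" := (hdot x y).

(** * Inner product: polarization, continuity, density *)

Section InnerProduct.
Set Implicit Arguments.
Unset Strict Implicit.
Variables (R : realType) (H : hilbertType R).
(* R[i] carries its topology only when seen as a numFieldType. *)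
Local Notation C := (Num.NumField.sort R[i]).
Implicit Types (x y z : H) (a : R[i]).

Lemma hdotC x y : '[x, y] = '[y, x]^*.
Proof. by rewrite (hermC hdot) /= expr0 mul1r. Qed.

Lemma hdotZl a x y : '[a *: x, y] = a * '[x, y].
Proof. by rewrite (linearZl_LR hdot). Qed.

Lemma hdotZr a x y : '[x, a *: y] = a^* * '[x, y].
Proof. by rewrite hdotC hdotZl rmorphM /= -hdotC. Qed.

Lemma conjC_i : 'i%C^* = - 'i%C :> R[i].
Proof. by rewrite complexiE conjCi. Qed.

(** With [d] for the inner product, the first bracket is [d] plus its conjugate. Conjugate-linearity
    in the second slot makes ['i%C] times the other bracket equal to [d] minus its conjugate. *)
Lemma hdot_polarization x y :
  2 * '[x, y] = (`|x + y| ^+ 2 - `|x| ^+ 2 - `|y| ^+ 2)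
              + 'i%C * (`|x + 'i%C *: y| ^+ 2 - `|x| ^+ 2 - `|'i%C *: y| ^+ 2).
Proof.
rewrite -!hdot_norm !(dnormD hdot) (hdotZr _ x) rmorphM /= conjCK conjC_i.
have ii : 'i%C * 'i%C = -1 :> R[i] by rewrite -expr2 sqr_i.
set d := '[x, y]; set e := d^*.
transitivity (d + e - ('i%C * 'i%C) * (d - e)); last by ring.
by rewrite ii; ring.
Qed.

(* Polarization reduces continuity to that of the norm; the Cauchy-Schwarz
   inequality of sesquilinear.v only covers finite-dimensional spaces. *)
Lemma hdotl_continuous y : continuous (fun x => '[x, y] : C).
Proof.
have norm_cont z : continuous (fun x : H => `|x + z| : C).
  move=> x; apply: (@continuous_comp _ _ _ (fun x => x + z) (fun x => `|x| : C)).
    by apply: cvgD; [exact: cvg_id | exact: cvg_cst].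
  exact: norm_continuous.
have normDsq z : continuous (fun x : H => `|x + z| ^+ 2 : C).
  by move=> x; apply: cvgM; exact: norm_cont.
have normsq : continuous (fun x : H => `|x| ^+ 2 : C).
  by move=> x; have := normDsq 0 x; under eq_fun do rewrite addr0.
move=> x.
have -> : (fun x => '[x, y] : C) = (fun x => 2^-1 *
    ((`|x + y| ^+ 2 - `|x| ^+ 2 - `|y| ^+ 2)
     + 'i%C * (`|x + 'i%C *: y| ^+ 2 - `|x| ^+ 2 - `|'i%C *: y| ^+ 2))).
  by apply/funext => z; rewrite -hdot_polarization mulKf ?pnatr_eq0.
have pol z :
    continuous (fun x : H => `|x + z| ^+ 2 - `|x| ^+ 2 - `|z| ^+ 2 : C).
  move=> u; apply: cvgB; last exact: cvg_cst.
  by apply: cvgB; [exact: normDsq | exact: normsq].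
apply: cvgM; first exact: cvg_cst.
apply: cvgD; first exact: pol.
by apply: cvgM; [exact: cvg_cst | exact: pol].
Qed.

Lemma complex_closed0 : closed [set 0 : C].
Proof.
apply: accessible_closed_set1; apply: hausdorff_accessible.
exact: (@norm_hausdorff C C).
Qed.

(** For nonzero [z], the points not orthogonal to [z] form an open set that contains [z], so this
    set would meet [A]. *)
Lemma hdot_dense_eq0 (A : set H) z :
  dense A -> (forall x, A x -> '[x, z] = 0) -> z = 0.
Proof.
move=> dA Az; apply/eqP; rewrite -(dnorm_eq0 hdot); apply: contrapT => /negP z0.
pose O := (fun x => '[x, z] : C) @^-1` ~` [set 0].
have oO : open O.
  apply: open_comp => [x _|]; first exact: hdotl_continuous.
  by apply: closed_openC; exact: complex_closed0.
have /dA/(_ oO) [x [Ox /Az]] : O !=set0 by exists z; exact/eqP.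
exact: Ox.
Qed.

End InnerProduct.

Lemma closure_image_sub (X Y : topologicalType) (f : X -> Y) (A : set X)
    (B : set Y) :
  continuous f -> f @` A `<=` B -> f @` closure A `<=` closure B.
Proof.
move=> ctf fAB _ [x clAx <-] U /ctf/clAx [y [Ay Uy]].
by exists (f y); split=> //; apply: fAB; exists y.
Qed.

(** * Graphs of the closure, the adjoint and the von Neumann extension *)

Section Operators.
Set Implicit Arguments.
Unset Strict Implicit.
Variables (R : realType) (H : hilbertType R).
Local Notation C := (Num.NumField.sort R[i]).
Implicit Types (P : set (H * H)) (T : operator H) (x y z : H).

(** Under this condition the value chosen by [operator_of_graph] is any [y] known to satisfy
    [P (x, y)]. *)
Definition functional_graph P := forall x y z, P (x, y) -> P (x, z) -> y = z.

Lemma operator_of_graphE P x y :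
  functional_graph P -> P (x, y) -> operator_of_graph P x = y.
Proof.
by move=> fP Pxy; apply: xget_unique => // z Pxz; exact: fP Pxz Pxy.
Qed.

Lemma operator_of_graphP P x :
  op_dom (operator_of_graph P) x -> P (x, operator_of_graph P x).
Proof. by move=> Px; exact: (@xgetPex _ 0 [set y | P (x, y)]). Qed.

Lemma G_invariant_graph (G : topologicalGroupType) (V : G -> H -> H) P :
  functional_graph P ->
  G_invariant V (operator_of_graph P) <->
  forall g x y, P (x, y) -> P (V g x, V g y).
Proof.
move=> fP; split=> [[Vdom VP] g x y Pxy|VP].
  have Px : op_dom (operator_of_graph P) x by exists y.
  have /operator_of_graphP : op_dom (operator_of_graph P) (V g x).
    by apply: Vdom; exists x.
  by rewrite -VP // (operator_of_graphE fP Pxy).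
split=> [g _ [x [y Pxy] <-]|g x /operator_of_graphP Px].
  by exists (V g y); exact: VP.
by rewrite (operator_of_graphE fP (VP g _ _ Px)).
Qed.

(** The relation inside [adjoint], usable without evaluating a chosen function. *)
Definition adjoint_graph T : set (H * H) :=
  [set p | forall x, op_dom T x -> '[T x, p.1] = '[x, p.2]].

Lemma adjoint_graph_functional T :
  densely_defined T -> functional_graph (adjoint_graph T).
Proof.
move=> dT x y z /= Txy Txz; apply/eqP; rewrite -subr_eq0; apply/eqP.
apply: (hdot_dense_eq0 dT) => w Tw.
rewrite (linearBr hdot) -[X in X - _](Txy _ Tw) -[X in _ - X](Txz _ Tw).
exact: subrr.
Qed.

Lemma deficiency_adjoint_graph T c x : densely_defined T ->
  op_ker (sub_scalar (adjoint T) c) x <-> adjoint_graph T (x, c *: x).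
Proof.
move=> /adjoint_graph_functional fT; split=> [[domx]|Tx].
  move=> /eqP; rewrite subr_eq0 => /eqP <-.
  exact: (@operator_of_graphP (adjoint_graph T)).
split; first by exists (c *: x).
by apply/eqP; rewrite subr_eq0; apply/eqP; exact: operator_of_graphE fT Tx.
Qed.

Lemma adjoint_graphD T x y x' y' : adjoint_graph T (x, y) ->
  adjoint_graph T (x', y') -> adjoint_graph T (x + x', y + y').
Proof.
by move=> Txy Txy' w Tw; rewrite !(linearDr hdot) /=; congr (_ + _);
  [exact: Txy|exact: Txy'].
Qed.

Lemma adjoint_graphB T x y x' y' : adjoint_graph T (x, y) ->
  adjoint_graph T (x', y') -> adjoint_graph T (x - x', y - y').
Proof.
by move=> Txy Txy' w Tw; rewrite !(linearBr hdot) /=; congr (_ - _);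
  [exact: Txy|exact: Txy'].
Qed.

(** For fixed [(u, v)] the difference of the two sides is continuous in [(x, y)] and vanishes on
    [op_graph T], hence on its closure. *)
Lemma closure_graph_adjoint T x y u v : closure (op_graph T) (x, y) ->
  adjoint_graph T (u, v) -> '[y, u] = '[x, v].
Proof.
move=> clT Tuv; apply/eqP; rewrite -subr_eq0; apply/eqP.
pose f (p : H * H) : C := '[p.2, u] - '[p.1, v].
have ctf : continuous f.
  move=> p; apply: cvgB.
    apply: (@continuous_comp _ _ _ snd (fun x => '[x, u] : C)).
      exact: cvg_snd.
    exact: hdotl_continuous.
  apply: (@continuous_comp _ _ _ fst (fun x => '[x, v] : C)).
    exact: cvg_fst.
  exact: hdotl_continuous.
have : closure [set 0 : C] (f (x, y)).
  apply: (closure_image_sub ctf (A := op_graph T)); last by exists (x, y).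
  by move=> _ [[w z] [/= Tw ->] <-]; rewrite /f /= Tuv // subrr.
by rewrite -(closure_id _).1 //; exact: complex_closed0.
Qed.

(** Symmetry puts each [(w, T w)] in the adjoint graph, so it can be paired with the points of the
    closure. *)
Lemma closure_sub_adjoint_graph T : symmetric_operator T ->
  closure (op_graph T) `<=` adjoint_graph T.
Proof.
move=> symT [x y] clT w Tw /=; rewrite hdotC [RHS]hdotC; congr (_^*).
by apply/esym/(closure_graph_adjoint clT) => z Tz; exact: symT.
Qed.

Lemma closure_graph_functional T : densely_defined T -> symmetric_operator T ->
  functional_graph (closure (op_graph T)).
Proof.
move=> dT symT x y z.
move=> /(closure_sub_adjoint_graph symT) + /(closure_sub_adjoint_graph symT).
exact: adjoint_graph_functional.
Qed.

(* D(closure T), N_+ and N_- are in direct sum: pairing the graph of the closure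
   with (a, i a) and (b, - i b) gives 2 i <a, a> = 0 and 2 i <b, b> = 0. *)
Lemma deficiency_sum_eq0 T a b : closure (op_graph T) (a + b, 'i%C *: (a - b)) ->
  adjoint_graph T (a, 'i%C *: a) -> adjoint_graph T (b, - 'i%C *: b) ->
  a = 0 /\ b = 0.
Proof.
have i2_neq0 : 2 * 'i%C != 0 :> R[i].
  by rewrite mulf_neq0 ?pnatr_eq0 // complexiE neq0Ci.
move=> clT /(closure_graph_adjoint clT) Ta /(closure_graph_adjoint clT) Tb.
split; apply/eqP; rewrite -(dnorm_eq0 hdot) -(inj_eq (mulfI i2_neq0)) mulr0.
  move: Ta; rewrite hdotZl hdotZr (linearBl hdot) (linearDl hdot) /= conjC_i.
  by move=> /eqP; rewrite -subr_eq0 => /eqP <-; apply/eqP; ring.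
move: Tb; rewrite hdotZl hdotZr (linearBl hdot) (linearDl hdot) /=.
rewrite rmorphN /= conjC_i.
by move=> /eqP; rewrite eq_sym -subr_eq0 => /eqP <-; apply/eqP; ring.
Qed.

(** The value of the closure enters as a component [y], so that membership is stated by graph
    relations alone. *)
Definition von_neumann_graph T (K : H -> H) : set (H * H) :=
  [set p | exists x y xi, [/\ closure (op_graph T) (x, y),
     adjoint_graph T (xi, 'i%C *: xi),
     p.1 = x + (xi + K xi) & p.2 = y + 'i%C *: (xi - K xi)]].

Lemma von_neumann_extensionE T K :
  densely_defined T -> symmetric_operator T ->
  von_neumann_extension T K = operator_of_graph (von_neumann_graph T K).
Proof.
move=> dT symT; have fcl := closure_graph_functional dT symT.
congr operator_of_graph; apply/seteqP; split=> [] [p q] /=.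
  move=> [x [xi [/(@operator_of_graphP (closure (op_graph T))) clx]]].
  move=> /(deficiency_adjoint_graph _ _ dT) Txi /= -> /= ->.
  by exists x, (op_closure T x), xi.
move=> [x [y [xi [clxy Txi /= -> /= ->]]]]; exists x, xi; split=> //.
- by exists y.
- exact/(deficiency_adjoint_graph _ _ dT).
- by congr (_ + _); apply/esym; exact: operator_of_graphE fcl clxy.
Qed.

(** The three summands lie in the adjoint graph separately; this is how the von Neumann graph is
    seen to be single-valued. *)
Lemma von_neumann_sub_adjoint_graph T (K : H -> H) : symmetric_operator T ->
  (forall xi, adjoint_graph T (xi, 'i%C *: xi) ->
    adjoint_graph T (K xi, - 'i%C *: K xi)) ->
  von_neumann_graph T K `<=` adjoint_graph T.
Proof.
move=> symT TK [_ _] /= [x [y [xi [clT Txi /= -> /= ->]]]].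
rewrite scalerBr -scaleNr; apply: adjoint_graphD.
  exact: closure_sub_adjoint_graph.
by apply: adjoint_graphD => //; exact: TK.
Qed.

End Operators.

(** * Action of the representation on the graphs *)

Section Invariance.
Set Implicit Arguments.
Unset Strict Implicit.
Variables (R : realType) (H : hilbertType R) (G : topologicalGroupType).
Variables (V : G -> H -> H) (T : operator H) (K : H -> H).
Hypothesis V_rep : strongly_continuous_unitary_rep V.
Hypothesis T_linear : linear_operator T.
Hypothesis T_invariant : G_invariant V T.
Implicit Types (x y : H) (g : G).

Lemma rep_dot g x y : '[V g x, V g y] = '[x, y].
Proof. exact: (unitary_isometry (rep_unitary V_rep g)). Qed.

Lemma repZD g a x y : V g (a *: x + y) = a *: V g x + V g y.
Proof. exact: (unitary_linear (rep_unitary V_rep g)). Qed.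

Lemma repD g x y : V g (x + y) = V g x + V g y.
Proof. by have := repZD g 1 x y; rewrite !scale1r. Qed.

Lemma rep0 g : V g 0 = 0.
Proof. by apply: (addIr (V g 0)); rewrite -repD !add0r. Qed.

Lemma repZ g a x : V g (a *: x) = a *: V g x.
Proof. by rewrite -[a *: x]addr0 repZD rep0 addr0. Qed.

Lemma repB g x y : V g (x - y) = V g x - V g y.
Proof. by rewrite repD -scaleN1r repZ scaleN1r. Qed.

Lemma repK g x : V g (V g^-1%g x) = x.
Proof. by rewrite -(repM V_rep) mulgV (rep1 V_rep). Qed.

Lemma rep_norm g x : `|V g x| = `|x|.
Proof.
apply/eqP; rewrite -(@eqrXn2 _ 2) //; apply/eqP.
by rewrite -!hdot_norm rep_dot.
Qed.

Lemma rep_operator_continuous g : continuous (V g).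
Proof.
move=> x; apply/cvgrPdist_lt => e e0.
near=> y; rewrite -repB rep_norm; near: y.
exact: cvgr_dist_lt.
Unshelve. all: by end_near. Qed.

Lemma closure_graph_invariant g x y :
  closure (op_graph T) (x, y) -> closure (op_graph T) (V g x, V g y).
Proof.
move=> clT; have ctV : continuous (fun p : H * H => (V g p.1, V g p.2)).
  move=> p; apply: cvg_pair.
    apply: (@continuous_comp _ _ _ fst (V g) p cvg_fst).
    exact: rep_operator_continuous.
  apply: (@continuous_comp _ _ _ snd (V g) p cvg_snd).
  exact: rep_operator_continuous.
apply: (closure_image_sub ctV (A := op_graph T)); last by exists (x, y).
move=> _ [[w z] [/= Tw ->] <-]; split=> /=; last exact: T_invariant.2.
by apply: (T_invariant.1 g); exists w.
Qed.

(** Writing [w] as [V g (V g^-1 w)] lets [V g] pass through [T] and cancel in both inner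
    products. *)
Lemma adjoint_graph_invariant g x y :
  adjoint_graph T (x, y) -> adjoint_graph T (V g x, V g y).
Proof.
move=> Txy w Tw /=; have Tgw : op_dom T (V g^-1%g w).
  by apply: (T_invariant.1 g^-1%g); exists w.
rewrite -{1}[w](repK g) -T_invariant.2 // rep_dot.
by rewrite -[in RHS](repK g w) rep_dot; exact: Txy.
Qed.

Hypothesis K_deficiency : forall xi, adjoint_graph T (xi, 'i%C *: xi) ->
  adjoint_graph T (K xi, - 'i%C *: K xi).

Lemma von_neumann_graph_invariant :
  (forall g x y, von_neumann_graph T K (x, y) ->
     von_neumann_graph T K (V g x, V g y)) <->
  (forall xi, adjoint_graph T (xi, 'i%C *: xi) ->
     forall g, V g (K xi) = K (V g xi)).
Proof.
have Vpos g xi : adjoint_graph T (xi, 'i%C *: xi) ->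
    adjoint_graph T (V g xi, 'i%C *: V g xi).
  by rewrite -repZ; exact: adjoint_graph_invariant.
split=> [VP xi Txi g|VK g _ _ [x [y [xi [clT Txi /= -> /= ->]]]]]; last first.
  exists (V g x), (V g y), (V g xi); split=> /=.
  - exact: closure_graph_invariant.
  - exact: Vpos.
  - by rewrite !repD VK.
  - by rewrite repD repZ repB VK.
have clT0 : closure (op_graph T) (0, 0).
  apply: subset_closure; case: T_linear => -[T0 _] Tlin; split=> //=.
  (* [T 0 = 0] follows from linearity at [1 *: 0 + 0] by cancelling [T 0]. *)
  apply/esym/(addIr (T 0)).
  by have := Tlin 1 0 0 T0 T0; rewrite !scale1r !addr0 add0r.
have /(VP g) : von_neumann_graph T K (xi + K xi, 'i%C *: (xi - K xi)).
  by exists 0, 0, xi; split=> //=; rewrite add0r.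
move=> [x [y [eta [clT Teta /= Ex /= Ey]]]].
(* Comparing components in [Ex] and [Ey] gives [a + b = x] and ['i%C *: (a - b) = y], with [a] in
   N_+ and [b] in N_-. *)
pose a := V g xi - eta; pose b := V g (K xi) - K eta.
have [||| ] := @deficiency_sum_eq0 _ _ T a b.
- have -> : a + b = x.
    by rewrite /a /b addrACA -opprD -repD Ex addrK.
  suff -> : 'i%C *: (a - b) = y by [].
  by rewrite /a /b opprD addrACA -opprD -repB scalerBr -repZ Ey addrK.
- by rewrite scalerBr; apply: adjoint_graphB => //; exact: Vpos.
- rewrite scalerBr; apply: adjoint_graphB; last exact: K_deficiency.
  by rewrite -repZ; apply: adjoint_graph_invariant; exact: K_deficiency.
- by move=> /eqP; rewrite subr_eq0 => /eqP -> /eqP; rewrite subr_eq0 => /eqP.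
Qed.

End Invariance.

Theorem theorem6p3 (R : realType) (H : hilbertType R)
  (G : topologicalGroupType) (V : G -> H -> H)
  (T : operator H) (K : H -> H)
  (H_separable : separable H)
  (V_rep : strongly_continuous_unitary_rep V)
  (T_linear : linear_operator T)
  (T_dense : densely_defined T)
  (T_invariant : G_invariant V T)
  (T_symmetric : symmetric_operator T)
  (K_unitary : unitary_between (deficiency_pos T) (deficiency_neg T) K) :
  G_invariant V (von_neumann_extension T K) <->
  (forall xi : H, deficiency_pos T xi ->
     forall g : G, V g (K xi) - K (V g xi) = 0).
Proof.
have Npos := fun x => deficiency_adjoint_graph 'i%C x T_dense.
have TK xi : adjoint_graph T (xi, 'i%C *: xi) ->
    adjoint_graph T (K xi, - 'i%C *: K xi).
  move=> /Npos Txi; apply/(deficiency_adjoint_graph _ _ T_dense).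
  change (deficiency_neg T (K xi)).
  by rewrite -(unitary_image K_unitary); exists xi.
(* Single-valuedness of the von Neumann graph is inherited from the adjoint graph containing it. *)
rewrite von_neumann_extensionE // G_invariant_graph; last first.
  move=> x y z.
  move=> /(von_neumann_sub_adjoint_graph T_symmetric TK) Txy.
  move=> /(von_neumann_sub_adjoint_graph T_symmetric TK).
  exact: adjoint_graph_functional Txy.
rewrite von_neumann_graph_invariant //.
split=> VK xi /Npos Txi g; first by rewrite VK // subrr.
by apply/eqP; rewrite -subr_eq0 VK.
Qed.
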